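(* Let $\mathcal T=D^2\times S^1$ be the solid torus and let $f:\mathcal T\to\mathcal T$ be $$f(x,y,\theta)=\Bigl(\tfrac14x+\tfrac12\cos\theta,\ \tfrac14y+\tfrac12\sin\theta,\ T(\theta)\Bigr),$$ where $T:S^1\to S^1$ is a $C^1$-small perturbation of the doubling map on the circle, such that $f$ is a $C^1$ diffeomorphism onto its image and is hyperbolic on its invariant set $\Lambda=\bigcap_{n\geqslant0}f^n\mathcal T$, and such that $T$ has no absolutely continuous (with respect to Lebesgue measure) invariant probability measure. Then $f$ has no SRB measure.
   Context: $D^2=\{(x,y)\in\mathbb R^2:x^2+y^2\leqslant1\}$ and $S^1=[0,2\pi]$ mod $2\pi$. The doubling map is $\theta\mapsto2\theta$ mod $2\pi$. The map $f$ is a $C^1$-small perturbation of the standard solenoid map $(x,y,\theta)\mapsto(\frac14x+\frac12\cos\theta,\frac14y+\frac12\sin\theta,2\theta)$; $\Lambda$ is a uniformly hyperbolic set with one-dimensional unstable manifolds. (The existence of arbitrarily $C^1$-small perturbations $T$ of the doubling map with no absolutely continuous invariant probability measure is a known result of Quas.) An SRB measure for $f$ is an $f$-invariant probability measure (on $\Lambda$) whose Rokhlin conditional measures with respect to a measurable partition subordinate to the unstable manifolds (a.e. atom is contained in an unstable manifold and contains a leafwise neighborhood of the point) are absolutely continuous with respect to the leafwise Riemannian volume. *)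

(* Defs.v *)
From HB Require Import structures.
From mathcomp Require Import all_boot all_order all_algebra.
From mathcomp Require Import all_classical all_reals all_analysis.
Set Implicit Arguments.
Unset Strict Implicit.
Unset Printing Implicit Defensive.
Import Order.TTheory GRing.Theory Num.Theory.
Import numFieldNormedType.Exports.
Local Open Scope classical_set_scope.
Local Open Scope ring_scope.

(* The circle R / 2 pi Z is represented by the angles in [0, 2 pi[, and the
   solid torus by the points ((x, y), theta) of R^3 with x^2 + y^2 <= 1 and
   theta in [0, 2 pi[.  The Borel sets of R^3 contained in [solid_torus] are
   exactly the Borel sets of the torus.  The topology and the smooth structure
   are NOT those of the subset of R^3: they are always taken through the
   covering map [covering]. *)
Notation euclid3 R := (R * R * R)%type.

Section SolidTorus.
Context {R : realType}.
Implicit Types (p q v : euclid3 R) (A W : set (euclid3 R)).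

Definition angle (t : R) : R :=
  t - 2 * pi * (Num.floor (t / (2 * pi)))%:~R.

Definition S1 : set R := `[0, 2 * pi[.

Definition D2 : set (R * R) := [set z | z.1 ^+ 2 + z.2 ^+ 2 <= 1].

Definition solid_torus : set (euclid3 R) := D2 `*` S1.

Definition covering p : euclid3 R := (p.1, angle p.2).

Definition euclidean v : R :=
  Num.sqrt (v.1.1 ^+ 2 + v.1.2 ^+ 2 + v.2 ^+ 2).

Definition circle_dist (s t : R) : R :=
  Num.min `|s - t| (2 * pi - `|s - t|).

(* flat distance, for p and q in [solid_torus] *)
Definition torus_dist p q : R :=
  euclidean (p.1 - q.1, circle_dist p.2 q.2).

Definition C1_on (U : set (euclid3 R)) (H : euclid3 R -> euclid3 R) : Prop :=
  forall q, U q ->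
    differentiable H q /\
    forall v, {for q, continuous (fun q' => 'd H q' v)}.

(* C^1 maps between arbitrary subsets of the manifold R^2 x S^1: near each
   point (of the universal cover R^3), the map is covered by the restriction
   of a C^1 map defined on an open set. *)
Definition C1_map A (h : euclid3 R -> euclid3 R) : Prop :=
  forall p, A (covering p) ->
    exists U : set (euclid3 R), exists H : euclid3 R -> euclid3 R,
      [/\ open U, U p, C1_on U H &
          forall q, U q -> A (covering q) -> covering (H q) = h (covering q)].

Definition C1_diffeo_onto_image A (h : euclid3 R -> euclid3 R) : Prop :=
  C1_map A h /\
  exists g : euclid3 R -> euclid3 R,
    C1_map (h @` A) g /\ {in A, cancel h g}.

(* A circle map T of degree 2 is given by a lift F to R, T = angle \o F. *)
Definition circle_map (F : R -> R) : R -> R := angle \o F.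

(* T is C^1 and eps-close to t |-> 2 t in the C^1 topology *)
Definition doubling_perturbation (eps : R) (F : R -> R) : Prop :=
  [/\ forall t, F (t + 2 * pi) = F t + 4 * pi,
      forall t, derivable F t 1,
      continuous (derive1 F) &
      forall t, `|F t - 2 * t| < eps /\ `|derive1 F t - 2| < eps].

Definition circle_acip (T : R -> R) (nu : probability R R) : Prop :=
  [/\ nu S1 = 1%E,
      forall B, measurable B -> nu (T @^-1` B) = nu B &
      nu `<< lebesgue_measure].

Definition solenoid_lift (F : R -> R) (p : euclid3 R) : euclid3 R :=
  (4^-1 * p.1.1 + 2^-1 * cos p.2, 4^-1 * p.1.2 + 2^-1 * sin p.2, F p.2).

Section Dynamics.
(* G is a map of R^3 commuting, through [covering], with a map of the torus. *)
Variable G : euclid3 R -> euclid3 R.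

Definition torus_map : euclid3 R -> euclid3 R := covering \o G.

Definition attractor : set (euclid3 R) :=
  \bigcap_(n in setT) (iter n torus_map @` solid_torus).

(* As [covering] is a local isometry, the derivative of the n-th iterate of
   [torus_map] is that of [iter n G]. *)
Definition hyperbolic_splitting (Es Eu : euclid3 R -> {vspace (euclid3 R)}) : Prop :=
  (forall p, attractor p ->
    [/\ (Es p + Eu p = fullv)%VS,
        (Es p :&: Eu p = 0)%VS,
        (linfun ('d G p) @: Es p = Es (torus_map p))%VS &
        (linfun ('d G p) @: Eu p = Eu (torus_map p))%VS]) /\
  exists C : R, exists lambda : R,
    [/\ 0 < C, 0 < lambda < 1 &
        forall p n v, attractor p ->
          (v \in Es p ->
             euclidean ('d (iter n G) p v) <= C * lambda ^+ n * euclidean v) /\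
          (v \in Eu p ->
             euclidean v <= C * lambda ^+ n * euclidean ('d (iter n G) p v))].

(* uniform hyperbolicity of the attractor, with unstable bundle of rank d *)
Definition uniformly_hyperbolic (d : nat) : Prop :=
  exists Es Eu : euclid3 R -> {vspace (euclid3 R)},
    hyperbolic_splitting Es Eu /\
    forall p, attractor p -> \dim (Eu p) = d.

Definition backward (n : nat) (p : euclid3 R) : euclid3 R :=
  iter n (pinv solid_torus torus_map) p.

Definition unstable_manifold p : set (euclid3 R) :=
  [set q | attractor q /\
           torus_dist (backward n p) (backward n q) @[n --> \oo] --> (0 : R)].

(* W is a one-dimensional injectively immersed C^1 submanifold, with
   parametrization [covering \o c]; its leafwise topology and volume are those
   transported by the parametrization. *)
Definition leaf_parametrization W (c : R -> euclid3 R) : Prop :=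
  [/\ forall t, derivable c t 1,
      continuous (derive1 c),
      forall t, derive1 c t != 0,
      injective (covering \o c) &
      range (covering \o c) = W].

(* Riemannian (arc length) measure on the leaf parametrized by c *)
Definition leaf_volume (c : R -> euclid3 R) A : \bar R :=
  (\int[lebesgue_measure]_(t in (covering \o c) @^-1` A)
     (euclidean (derive1 c t))%:E)%E.

Definition leaf_nbhs (c : R -> euclid3 R) p A : Prop :=
  exists t : R, covering (c t) = p /\ \forall s \near t, A (covering (c s)).

Variable mu : probability (euclid3 R) R.

(* A partition of the attractor is given by the map xi sending a point to its
   atom.  Measurability is in Rokhlin's sense: modulo a null set, there is a
   countable family of measurable unions of atoms that separates atoms. *)
Definition is_partition (xi : euclid3 R -> set (euclid3 R)) : Prop :=
  forall p, attractor p ->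
    [/\ xi p `<=` attractor, xi p p & forall q, xi p q -> xi q = xi p].

Definition measurable_partition (xi : euclid3 R -> set (euclid3 R)) : Prop :=
  is_partition xi /\
  exists2 X0 : set (euclid3 R),
    [/\ measurable X0, mu X0 = 1%E & X0 `<=` attractor] &
    exists2 B : nat -> set (euclid3 R),
      (forall n, measurable (B n)) &
      forall p q, X0 p -> X0 q -> (xi p q <-> forall n, B n p <-> B n q).

Definition subordinate_unstable (xi : euclid3 R -> set (euclid3 R)) : Prop :=
  {ae mu, forall p, xi p `<=` unstable_manifold p /\
     exists c, leaf_parametrization (unstable_manifold p) c /\
               leaf_nbhs c p (xi p)}.

(* Rokhlin's canonical system of conditional measures of mu along xi:
   [kappa p] is the conditional measure on the atom of p. *)
Definition conditional_measures (xi : euclid3 R -> set (euclid3 R))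
    (kappa : R.-pker (euclid3 R) ~> (euclid3 R)) : Prop :=
  [/\ {ae mu, forall p, {ae kappa p, forall q, xi p q}},
      exists2 X0 : set (euclid3 R),
        [/\ measurable X0, mu X0 = 1%E & X0 `<=` attractor] &
        forall p q, X0 p -> X0 q -> xi p q ->
          forall A, measurable A -> kappa p A = kappa q A &
      forall A, measurable A -> mu A = (\int[mu]_p kappa p A)%E].

Definition abs_continuous_conditionals
    (kappa : R.-pker (euclid3 R) ~> (euclid3 R)) : Prop :=
  {ae mu, forall p, exists c,
     leaf_parametrization (unstable_manifold p) c /\
     kappa p `<< leaf_volume c}.

Definition SRB_measure : Prop :=
  [/\ mu attractor = 1%E,
      forall A, measurable A -> mu (torus_map @^-1` A) = mu A &
      exists xi : euclid3 R -> set (euclid3 R),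
        [/\ measurable_partition xi, subordinate_unstable xi &
            exists2 kappa : R.-pker (euclid3 R) ~> (euclid3 R),
              conditional_measures xi kappa &
              abs_continuous_conditionals kappa]].

End Dynamics.
End SolidTorus.

(* Main.v *)
Require Import Defs.
From mathcomp Require Import all_boot all_order all_algebra.
From mathcomp Require Import all_classical all_reals all_analysis.
From mathcomp Require Import measurable_realfun ring lra.
Set Implicit Arguments.
Unset Strict Implicit.
Unset Printing Implicit Defensive.
Import Order.TTheory GRing.Theory Num.Theory.
Import numFieldNormedType.Exports.
Local Open Scope classical_set_scope.
Local Open Scope ring_scope.

(** The angular projection semiconjugates the solenoid map to the circle map
    [T = circle_map F], so it pushes an SRB measure [mu] to a [T]-invariant
    probability carried by the circle.  The point is that this image is
    absolutely continuous, which contradicts the choice of [T].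

    Disintegrate [mu] along the unstable manifolds: it is enough that a
    Lebesgue null set [N] of angles is seen by each leaf in a set of parameters
    of measure zero ([negligible_leaf_angle_preimage]).  On the standard leaf
    this is clear, because an unstable manifold is a graph over the angular
    coordinate of the universal cover.  Here the leaf is only known as a set of
    points with asymptotic backward orbits, with an arbitrary injective [C^1]
    parametrization [c], so the graph property is obtained piecewise and
    directly from backward orbits, without constructing the leaf.

    Fix [p] in the leaf and cut the parameter line into countably many pieces:
    [s] and [t] are in the same piece when, from a common time [i] on, both
    backward orbits shadow that of [p], and before time [i] their angles have
    the same integer parts.  Within a piece the backward angles of two points
    are always within distance 1 on the circle; as [F' >= 3/2], their
    distance decreases along backward orbits.  The disc coordinate is the sum
    of the series of [4^-(k-1) * exp(i theta_k) / 2] over the backward angles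
    [theta_k], hence two such points with angular distance [d] have disc
    coordinates within [d] of each other ([history_graph]).  So, inside a piece
    and near a given parameter, the angle of [c] moves at least as much as the
    other coordinates; since [c' <> 0], it moves at speed bounded below
    ([derivable_locally_expanding]).  A function which is locally expanding on
    a set pulls null sets back to null subsets of it
    ([negligible_preimage_locally_expanding]), and countably many pieces
    suffice.

    The argument works as soon as [F'] stays within [1/2] of [2]; the constant
    1 for the angular distances is small enough because
    [1 + 5/2 < 4 <= 2 * pi], so no wrapping around the circle occurs. *)

(** * Null sets under expanding maps *)

(** A cover of [N] by intervals of small total length pulls back, within [E],
    to sets of diameter at most that length divided by [m]. *)
Lemma negligible_preimage_expanding (R : realType) (E N : set R)
    (g : R -> R) (m : R) :
  0 < m ->
  (forall s t, E s -> E t -> m * `|s - t| <= `|g s - g t|) ->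
  lebesgue_measure.-negligible N ->
  lebesgue_measure.-negligible (E `&` g @^-1` N).
Proof.
move=> m0 gE /negligible_outer_measure N0; apply/negligible_outer_measure.
set A := E `&` _.
apply/eqP; rewrite eq_le outer_measure_ge0 andbT.
apply/lee_addgt0Pr => e e0; rewrite add0e.
have I0 : ereal_inf [set (\sum_(k <oo) wlength idfun (F k))%E
                 | F in open_itv_cover N] = 0%E.
  by rewrite -outer_measure_open_itv_cover.
(* the pull-back of an interval of length [l] is put in a ball of radius
   [l / m], whose length is [2 * l / m] *)
have em0 : 0 < e * m / 2 by rewrite divr_gt0// mulr_gt0.
have If : ereal_inf [set (\sum_(k <oo) wlength idfun (F k))%E
                 | F in open_itv_cover N] \is a fin_num by rewrite I0.
have [_ [/= F [Fitv NF] <-]] := lb_ereal_inf_adherent em0 If.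
rewrite I0 add0e => Fe.
have H k : exists G : set R, A `&` g @^-1` (F k) `<=` G /\
    (lebesgue_measure G <= (2 / m)%:E * wlength idfun (F k))%E.
  have [[x [Ax Fx]]|A0] := pselect (exists x, A x /\ F k (g x)); last first.
    exists set0; split; first by move=> x [Ax Fx]; apply: A0; exists x.
    by rewrite measure0 mule_ge0// ?lee_fin ?divr_ge0// ?ltW// wlength_ge0.
  have [[a b] /= Fab] := Fitv k.
  rewrite Fab in Fx; move: Fx; rewrite /= in_itv/= => /andP[ax xb].
  have ab : a < b := lt_trans ax xb.
  exists (closed_ball x ((b - a) / m)); split.
    move=> y [Ay]; rewrite /preimage Fab => /=.
    rewrite in_itv/= => /andP[ay yb].
    rewrite closed_ball_itv ?divr_gt0 ?subr_gt0//= in_itv/= -ler_distlC.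
    rewrite ler_pdivlMr// mulrC.
    apply: (le_trans (gE _ _ _ _)); [by case: Ax|by case: Ay|].
    by rewrite ler_norml; apply/andP; split; lra.
  rewrite lebesgue_measure_closed_ball; last first.
    by rewrite divr_ge0 ?subr_ge0// ltW.
  rewrite Fab wlength_itv /= lte_fin ab -EFinD -EFinM lee_fin.
  by rewrite -mulr_natr le_eqVlt; apply/orP; left; apply/eqP; ring.
pose G k := sval (cid (H k)).
have HG k : A `&` g @^-1` (F k) `<=` G k /\
    (lebesgue_measure (G k) <= (2 / m)%:E * wlength idfun (F k))%E.
  by rewrite /G; case: cid.
have AG : A `<=` \bigcup_k G k.
  move=> x Ax; have [k _ Fk] := NF _ Ax.2.
  by exists k => //; apply: (HG k).1.
apply: (@le_trans _ _ ((wlength idfun)^* (\bigcup_k G k))%mu).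
  exact: le_outer_measure.
apply: (le_trans (outer_measure_sigma_subadditive _ _)).
apply: (@le_trans _ _ (\sum_(k <oo) ((2 / m)%:E * wlength idfun (F k)))%E).
  apply: lee_nneseries => k; first by move=> *; exact: outer_measure_ge0.
  by move=> _; exact: (HG k).2.
rewrite nneseriesZl; [|by move=> *; exact: wlength_ge0].
rewrite -(_ : (2 / m)%:E * (e * m / 2)%:E = e%:E)%E.
  by rewrite lee_pmul2l// ?lte_fin ?divr_gt0//; exact: ltW.
by rewrite -EFinM; congr EFin; field; exact: lt0r_neq0.
Qed.

Lemma negligible_countable_bigcup d (T : sigmaRingType d) (R : realFieldType)
    (mu : {measure set T -> \bar R}) (I : countType) (F : I -> set T) :
  (forall i, mu.-negligible (F i)) -> mu.-negligible (\bigcup_i F i).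
Proof.
move=> F0; apply: (@negligibleS _ _ _ _
  (\bigcup_k (if unpickle k is Some i then F i else set0))).
  by move=> x [i _ Fx]; exists (pickle i) => //; rewrite pickleK.
apply: negligible_bigcup => k.
by case: unpickle => [i|]; [exact: F0|exact: negligible_set0].
Qed.

Lemma dist_lt1_floor (R : realType) (x y : R) :
  Num.floor x = Num.floor y -> `|x - y| < 1.
Proof.
move=> xy; have := floor_itv x; have := floor_itv y.
rewrite xy intrD => /andP[? ?] /andP[? ?].
by rewrite ltr_norml; apply/andP; split; lra.
Qed.

(** Expansion is only asked between points of [E], at a scale and with a rate
    that may depend on the point: countably many pieces of [E] have uniform
    scale and rate [1 / j.+1] and diameter less than that scale. *)
Lemma negligible_preimage_locally_expanding (R : realType) (E N : set R)
    (g : R -> R) :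
  (forall t, E t -> exists2 m, 0 < m &
     \forall s \near t, E s -> m * `|s - t| <= `|g s - g t|) ->
  lebesgue_measure.-negligible N ->
  lebesgue_measure.-negligible (E `&` g @^-1` N).
Proof.
move=> gE N0.
pose P (ji : nat * int) := [set t | [/\ E t,
  forall s, E s -> `|s - t| * ji.1.+1%:R < 1 ->
     ji.1.+1%:R^-1 * `|s - t| <= `|g s - g t| &
  Num.floor (t * ji.1.+1%:R) = ji.2]].
suff PN : lebesgue_measure.-negligible (\bigcup_ji (P ji `&` g @^-1` N)).
  apply: negligibleS PN => t [Et Nt].
  have [m m0 [r /= r0 tr]] := gE t Et.
  have [j] : exists j : nat, m^-1 + r^-1 < j.+1%:R.
    exists (Num.truncn (m^-1 + r^-1)); apply: truncnS_gt.
  move=> jmr.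
  have j0 : 0 < j.+1%:R :> R by [].
  have m'0 : 0 < m^-1 by rewrite invr_gt0.
  have r'0 : 0 < r^-1 by rewrite invr_gt0.
  have jm : j.+1%:R^-1 < m by rewrite invf_plt ?posrE//; lra.
  have jr : j.+1%:R^-1 < r by rewrite invf_plt ?posrE//; lra.
  exists (j, Num.floor (t * j.+1%:R)) => //; split => //; split => //= s Es st.
  apply: (@le_trans _ _ (m * `|s - t|)); first by rewrite ler_wpM2r// ltW.
  apply: tr => //=; rewrite distrC; apply: lt_trans jr.
  by rewrite -[ltRHS]mul1r ltr_pdivlMr.
apply: negligible_countable_bigcup => -[j i].
apply: (@negligible_preimage_expanding _ _ _ _ (j.+1%:R^-1)) => //.
move=> s t [Es _ si] [Et Pt ti]; apply: Pt => //.
rewrite -[X in _ * X]ger0_norm// -normrM mulrBl.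
by apply: dist_lt1_floor; rewrite si ti.
Qed.

Lemma negligible_preimage_angle (R : realType) (N : set R) :
  lebesgue_measure.-negligible N ->
  lebesgue_measure.-negligible (angle @^-1` N).
Proof.
move=> N0; suff tN : lebesgue_measure.-negligible
    (\bigcup_(k : int) ([set: R] `&` (fun t : R => t - 2 * pi * k%:~R) @^-1` N)).
  by apply: negligibleS tN => t Nt; exists (Num.floor (t / (2 * pi))).
apply: negligible_countable_bigcup => k.
apply: (@negligible_preimage_expanding _ _ _ _ 1) => // s t _ _.
by rewrite mul1r opprB addrA subrK.
Qed.

(** * Points of the circle and their lifts *)

Lemma affine_dist_le_derive (R : realType) (f : R -> R) (a e : R) :
  (forall t, derivable f t 1) -> (forall t, `|derive1 f t - a| <= e) ->
  forall s t, `|f s - f t - a * (s - t)| <= e * `|s - t|.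
Proof.
move=> df fae.
suff lt_case s t : s <= t -> `|f s - f t - a * (s - t)| <= e * `|s - t|.
  move=> s t; have [/lt_case//|/ltW/lt_case] := leP s t.
  have -> : f s - f t - a * (s - t) = - (f t - f s - a * (t - s)) by ring.
  by rewrite normrN (distrC s).
move=> st; have fd (x : R) : is_derive x (1 : R) f (derive1 f x).
  by rewrite derive1E; apply/derivableP.
have [|x _ fx] := MVT_segment st (fun x _ => fd x).
  apply: continuous_subspaceT => x; apply: differentiable_continuous.
  exact/derivable1_diffP.
have -> : f s - f t - a * (s - t) = - ((derive1 f x - a) * (t - s)).
  by rewrite mulrBl -fx; ring.
by rewrite normrN normrM (distrC s) ler_wpM2r.
Qed.

Definition eq2pi (R : realType) (s t : R) :=
  exists k : int, s - t = 2 * pi * k%:~R.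

Section Circle.
Variable R : realType.
Implicit Types s t u x : R.

Lemma eq2pi_refl t : eq2pi t t.
Proof. by exists 0; rewrite mulr0 subrr. Qed.

Lemma eq2pi_sub s s' t t' : eq2pi s s' -> eq2pi t t' -> eq2pi (s - t) (s' - t').
Proof.
move=> [k Hk] [l Hl]; exists (k - l); rewrite intrB mulrBr -Hk -Hl; ring.
Qed.

Lemma eq2pi_sym s t : eq2pi s t -> eq2pi t s.
Proof. by move=> [k Hk]; exists (- k); rewrite intrN mulrN -Hk opprB. Qed.

Lemma eq2pi_trans s t u : eq2pi s t -> eq2pi t u -> eq2pi s u.
Proof.
move=> [k Hk] [l Hl]; exists (k + l); rewrite intrD mulrDr -Hk -Hl; ring.
Qed.

Lemma eq2pi_angle t : eq2pi (angle t) t.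
Proof.
exists (- Num.floor (t / (2 * pi))).
by rewrite intrN mulrN /angle addrAC subrr add0r.
Qed.

(** The constant is a rational lower bound of [2 * pi]. *)
Lemma eq2pi_eq s t : eq2pi s t -> `|s - t| < 4 -> s = t.
Proof.
move=> [k Hk]; rewrite Hk normrM ger0_norm ?mulr_ge0 ?pi_ge0// => k4.
have [k0|k0] := eqVneq k 0; first by apply/subr0_eq; rewrite Hk k0 mulr0.
have : 1 <= `|k%:~R| :> R by rewrite -intr_norm ler1z -gtz0_ge1 normr_gt0.
have := pi_ge2 R; nra.
Qed.

Lemma periodic_eq2pi (f : R -> R) : periodic f (pi *+ 2) ->
  forall s t, eq2pi s t -> f s = f t.
Proof.
move=> fp; suff H s t (k : nat) : s - t = 2 * pi * k%:R -> f s = f t.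
  move=> s t [[k|k] kE]; first exact: H kE.
  apply/esym; apply: (H _ _ k.+1); rewrite -opprB kE NegzE intrN mulrN opprK//.
move=> /(canRL (subrK _)) ->; rewrite addrC mulr_natr mulr_natl.
exact: periodicn.
Qed.

Lemma circle_dist_eq2pi s t r : S1 s -> S1 t -> circle_dist s t < r ->
  exists2 x, eq2pi x (s - t) & `|x| < r.
Proof.
rewrite /S1/= !in_itv/= => /andP[s0 s2] /andP[t0 t2].
rewrite /circle_dist gt_min => /orP[str|].
  by exists (s - t) => //; exact: eq2pi_refl.
have [st|/ltW st] := lerP 0 (s - t).
  rewrite (ger0_norm st) => str; exists (s - t - 2 * pi).
    by exists (-1); rewrite mulrN1 addrAC subrr add0r.
  by rewrite ler0_norm ?opprB//; lra.
rewrite (ler0_norm st) => str; exists (s - t + 2 * pi).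
  by exists 1; rewrite mulr1 addrAC subrr add0r.
by rewrite ger0_norm//; lra.
Qed.

Lemma cos_dist s t : `|cos s - cos t| <= `|s - t|.
Proof.
have := @affine_dist_le_derive R cos 0 1 _ _ s t.
rewrite mul0r subr0 mul1r; apply=> x; first by have [] := is_derive_cos x.
by rewrite derive1E derive_val subr0 normrN; exact: sin_max.
Qed.

Lemma sin_dist s t : `|sin s - sin t| <= `|s - t|.
Proof.
have := @affine_dist_le_derive R sin 0 1 _ _ s t.
rewrite mul0r subr0 mul1r; apply=> x; first by have [] := is_derive_sin x.
by rewrite derive1E derive_val subr0 cos_max.
Qed.

Lemma angle_S1 t : S1 (angle t).
Proof.
have pi2 : 0 < 2 * pi :> R by rewrite mulr_gt0// pi_gt0.
rewrite /S1/= in_itv/= /angle.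
have := floor_itv (t / (2 * pi)); rewrite intrD => /andP[].
by rewrite ler_pdivlMr// ltr_pdivrMr// => *; apply/andP; split; lra.
Qed.

Lemma circle_dist_le_torus (p q : euclid3 R) :
  circle_dist p.2 q.2 <= torus_dist p q.
Proof.
rewrite /torus_dist /euclidean/=; apply: le_trans (ler_norm _) _.
by rewrite -sqrtr_sqr ler_wsqrtr// lerDr addr_ge0// sqr_ge0.
Qed.

End Circle.

(** * Backward orbits of the solenoid map *)

(** The fixed point [2 / 3 * D] of the affine bound is below [D], and what is
    assumed about the far past is contracted away. *)
Lemma le_contraction_seq (R : realType) (u : nat -> R) (M D : R) :
  (forall n, u n <= M) -> (forall n, u n <= 4^-1 * u n.+1 + 2^-1 * D) ->
  0 <= D -> u 0 <= D.
Proof.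
move=> uM uD D0.
have H k n : u n <= M * 4^-1 ^+ k + D.
  elim: k n => [|k IH] n; first by rewrite expr0 mulr1; have := uM n; lra.
  by rewrite exprS; have := uD n; have := IH n.+1; lra.
have M4 : M * 4^-1 ^+ k @[k --> \oo] --> (0 : R).
  rewrite -(mulr0 M); apply: cvgMr; apply: cvg_expr.
  by rewrite ger0_norm ?invr_ge0//; lra.
have : M * 4^-1 ^+ k + D @[k --> \oo] --> (0 + D : R).
  by apply: cvgD => //; exact: cvg_cst.
rewrite add0r => MD; rewrite -(cvg_lim _ MD)//.
by apply: limr_ge; [exact: cvgP MD|exact: nearW].
Qed.

Lemma solenoid_coord_le (R : realType) (a a' b b' D : R) :
  `|b - b'| <= D ->
  `|(4^-1 * a + 2^-1 * b) - (4^-1 * a' + 2^-1 * b')|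
    <= 4^-1 * `|a - a'| + 2^-1 * D.
Proof.
move=> bD.
rewrite (_ : _ - _ = 4^-1 * (a - a') + 2^-1 * (b - b')); last by ring.
rewrite (le_trans (ler_normD _ _))// !normrM !normfV !normr_nat.
by rewrite lerD2l ler_wpM2l ?invr_ge0.
Qed.

Section Histories.
Variables (R : realType) (F : R -> R).
Hypothesis F_pert : doubling_perturbation 2^-1 F.

Let F_dist s t : `|F s - F t - 2 * (s - t)| <= 2^-1 * `|s - t|.
Proof.
have [_ dF _ F2] := F_pert; apply: affine_dist_le_derive => // x.
by apply/ltW; have [] := F2 x.
Qed.

Lemma eq2pi_lift s t : eq2pi s t -> eq2pi (F s) (F t).
Proof.
have [Fp _ _ _] := F_pert.
suff H (k : nat) s' t' : s' - t' = 2 * pi * k%:R -> eq2pi (F s') (F t').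
  move=> [[k|k] kE]; first exact: H kE.
  apply/eq2pi_sym; apply: (H k.+1); rewrite -opprB kE NegzE intrN mulrN opprK//.
elim: k s' => [|k IH] s'.
  by rewrite mulr0 => /subr0_eq ->; exact: eq2pi_refl.
move=> st.
have /IH : (s' - 2 * pi) - t' = 2 * pi * k%:R.
  by rewrite addrAC st -addn1 natrD; ring.
apply: eq2pi_trans; exists 2.
have := Fp (s' - 2 * pi); rewrite subrK => ->; ring.
Qed.

(** Indexed backwards in time: [p n] is a point of the past of [p 0]. *)
Definition history (p : nat -> euclid3 R) :=
  forall n, solid_torus (p n) /\ torus_map (solenoid_lift F) (p n.+1) = p n.

(** Both [x] and the increment of [F] over [y] represent the difference of the
    angles at time [n]; they are too small to differ by a nonzero multiple of
    [2 * pi], so they are equal, and [F] expands distances. *)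
Lemma history_angle_dist (p p' : nat -> euclid3 R) n x y :
  history p -> history p' ->
  eq2pi x ((p n).2 - (p' n).2) -> `|x| <= 1 ->
  eq2pi y ((p n.+1).2 - (p' n.+1).2) -> `|y| <= 1 -> `|y| <= `|x|.
Proof.
move=> hp hp' Hx x1 Hy y1.
set t := (p n.+1).2 in Hy; set t' := (p' n.+1).2 in Hy.
have pE : (p n).2 = angle (F t) by rewrite -(hp n).2.
have p'E : (p' n).2 = angle (F t') by rewrite -(hp' n).2.
have yt : eq2pi (t' + y) t.
  by case: Hy => k Hk; exists k; rewrite -Hk; ring.
have xE : eq2pi (F (t' + y) - F t') x.
  apply: eq2pi_trans (eq2pi_sym Hx); apply: eq2pi_sub.
    rewrite pE; apply: (eq2pi_trans (eq2pi_lift yt)).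
    exact/eq2pi_sym/eq2pi_angle.
  by rewrite p'E; exact/eq2pi_sym/eq2pi_angle.
have := F_dist (t' + y) t'; rewrite [t' + y - t']addrAC subrr add0r => Fd.
have {}xE : F (t' + y) - F t' = x.
  apply: eq2pi_eq xE _.
  have := ler_distD (2 * y) (F (t' + y) - F t') x.
  have := ler_normB (2 * y) x; rewrite normrM (ger0_norm (ler0n _ 2)); lra.
move: Fd; rewrite xE => Fd.
have : `|2 * y| <= `|x| + 2^-1 * `|y|.
  have := ler_distD x (2 * y) 0; rewrite !subr0 (distrC _ x); lra.
rewrite normrM (ger0_norm (ler0n _ 2)); have := normr_ge0 x; lra.
Qed.

(** The disc coordinate of [p 0] is the sum of a geometrically convergent
    series in the angles of the past, all of which are closer than those at
    time 0 by [history_angle_dist]. *)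
Lemma history_graph (p p' : nat -> euclid3 R) (x : R) :
  history p -> history p' ->
  (forall n, exists2 y, eq2pi y ((p n).2 - (p' n).2) & `|y| <= 1) ->
  eq2pi x ((p 0).2 - (p' 0).2) -> `|x| <= 1 ->
  `|(p 0).1 - (p' 0).1| <= `|x|.
Proof.
move=> hp hp' close Hx x1.
have [y Hy y1] : exists2 y : nat -> R,
    forall n, eq2pi (y n) ((p n).2 - (p' n).2) & forall n, `|y n| <= 1.
  by exists (fun n => sval (cid2 (close n))) => n; case: cid2.
have yx n : `|y n| <= `|x|.
  elim: n => [|n IH]; last first.
    apply: le_trans IH.
    exact: history_angle_dist hp hp' (Hy n) (y1 n) (Hy n.+1) (y1 n.+1).
  suff -> : y 0 = x by [].
  apply: (eq2pi_eq (eq2pi_trans (Hy 0) (eq2pi_sym Hx))).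
  have := ler_normB (y 0) x; have := y1 0; lra.
have shift n : eq2pi ((p' n).2 + y n) (p n).2.
  by case: (Hy n) => k Hk; exists k; rewrite -Hk; ring.
have pE (q : nat -> euclid3 R) n : history q ->
    (q n).1 = (4^-1 * (q n.+1).1.1 + 2^-1 * cos (q n.+1).2,
               4^-1 * (q n.+1).1.2 + 2^-1 * sin (q n.+1).2).
  by move=> hq; rewrite -[in LHS](hq n).2.
have disc (q : nat -> euclid3 R) n : history q ->
    `|(q n).1.1| <= 1 /\ `|(q n).1.2| <= 1.
  move=> /(_ n) [[+ _] _]; rewrite /D2 /= => q1.
  have := sqr_ge0 (q n).1.1; have := sqr_ge0 (q n).1.2.
  by split; rewrite -(@expr_le1 _ 2)// -normrX ger0_norm ?sqr_ge0//; lra.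
rewrite prod_normE ge_max; apply/andP; split.
- apply: (@le_contraction_seq R (fun n => `|(p n).1.1 - (p' n).1.1|) 2) => //.
    move=> n; have [? _] := disc p n hp; have [? _] := disc p' n hp'.
    by apply: (le_trans (ler_normB _ _)); lra.
  move=> n; rewrite (pE p n hp) (pE p' n hp') /=.
  apply: solenoid_coord_le; apply: le_trans (yx n.+1).
  rewrite -(periodic_eq2pi (@cosD2pi R) (shift n.+1)).
  by rewrite (le_trans (cos_dist _ _))// addrAC subrr add0r.
- apply: (@le_contraction_seq R (fun n => `|(p n).1.2 - (p' n).1.2|) 2) => //.
    move=> n; have [_ ?] := disc p n hp; have [_ ?] := disc p' n hp'.
    by apply: (le_trans (ler_normB _ _)); lra.
  move=> n; rewrite (pE p n hp) (pE p' n hp') /=.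
  apply: solenoid_coord_le; apply: le_trans (yx n.+1).
  rewrite -(periodic_eq2pi (@sinD2pi R) (shift n.+1)).
  by rewrite (le_trans (sin_dist _ _))// addrAC subrr add0r.
Qed.

End Histories.

Lemma torus_map_solid (R : realType) (F : R -> R) p :
  solid_torus p -> solid_torus (torus_map (solenoid_lift F) p).
Proof.
move=> [+ _]; rewrite /D2/= => p1; split; last exact: angle_S1.
rewrite /D2/=; have := cos2Dsin2 p.2.
set c := cos _; set s := sin _; set x := p.1.1 in p1 *; set y := p.1.2 in p1 *.
move=> cs; rewrite expr2 expr2 in cs; rewrite !expr2 in p1 *.
(* positivity of this square gives [x * c + y * s <= 1] *)
have : 0 <= (x - c) * (x - c) + (y - s) * (y - s).
  by rewrite addr_ge0// -expr2 sqr_ge0.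
nra.
Qed.

Section Attractor.
Variables (R : realType) (F : R -> R).
Local Notation f := (torus_map (solenoid_lift F)).
Hypothesis f_diffeo : C1_diffeo_onto_image solid_torus f.

Lemma torus_map_inj : {in solid_torus &, injective f}.
Proof.
by case: f_diffeo => _ [g [_ gK]]; exact: can_in_inj gK.
Qed.

(** The attractor is backward invariant: by injectivity on the solid torus, the
    chosen preimage of [q = f^(n+1) r] is [f^n r]. *)
Lemma attractor_pinv q : attractor (solenoid_lift F) q ->
  attractor (solenoid_lift F) (pinv solid_torus f q) /\
  f (pinv solid_torus f q) = q.
Proof.
move=> Aq; have fpq : f (pinv solid_torus f q) = q.
  by apply: pinvK; rewrite inE; exact: (Aq 1).
split=> // n _; have [r Tr rq] := Aq n.+1 Logic.I.
exists r => //; rewrite -rq iterS pinvKV//; first exact: torus_map_inj.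
by rewrite inE; elim: n {rq} => //= n; exact: torus_map_solid.
Qed.

Lemma backward_history q : attractor (solenoid_lift F) q ->
  history F (fun n => backward (solenoid_lift F) n q).
Proof.
move=> Aq; have An n :
    attractor (solenoid_lift F) (backward (solenoid_lift F) n q).
  by elim: n => // n IH; exact: (attractor_pinv IH).1.
move=> n; split; last exact: (attractor_pinv (An n)).2.
by have [r Tr <-] := An n 0 Logic.I.
Qed.

End Attractor.

(** * Angles along an unstable leaf *)

Lemma derivable_locally_expanding (R : realType) (V : normedModType R)
    (c : R -> V) (t : R) :
  derivable c t 1 -> derive1 c t != 0 ->
  exists2 m, 0 < m & \forall s \near t, m * `|s - t| <= `|c s - c t|.
Proof.
move=> dc c0; exists (`|derive1 c t| / 2); first by rewrite divr_gt0// normr_gt0.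
have m1 : `|derive1 c t| / 2 < `|derive1 c t|.
  by rewrite ltr_pdivrMr// ltr_pMr ?normr_gt0// ltr1n.
have H : h^-1 *: (c (h + t) - c t) @[h --> 0^'] --> derive1 c t.
  move: dc; rewrite /derivable /derive1.
  under eq_fun do rewrite /= [_ *: 1]mulr1.
  exact.
have /= := cvgr_norm_gt _ H _ m1; rewrite near_withinE => H'.
rewrite (near_shift 0) subr0; near=> h => /=.
rewrite addrK; have [->|h0] := eqVneq h 0; first by rewrite normr0 mulr0.
have /(_ h0)/ltW : h != 0 -> `|derive1 c t| / 2 < `|h^-1 *: (c (h + t) - c t)|.
  by near: h; exact: H'.
by rewrite normrZ normfV [_^-1 * _]mulrC ler_pdivlMr ?normr_gt0.
Unshelve. all: by end_near. Qed.

Section Leaf.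
Variables (R : realType) (F : R -> R).
Local Notation G := (solenoid_lift F).
Hypothesis F_pert : doubling_perturbation 2^-1 F.
Hypothesis f_diffeo : C1_diffeo_onto_image solid_torus (torus_map G).

Lemma negligible_leaf_angle_preimage (p : euclid3 R) (c : R -> euclid3 R)
    (N : set R) :
  attractor G p -> leaf_parametrization (unstable_manifold G p) c ->
  lebesgue_measure.-negligible N ->
  lebesgue_measure.-negligible [set t | N (angle (c t).2)].
Proof.
move=> Ap [dc _ c0 _ cW] N0.
pose b t n := backward G n (covering (c t)).
have W t : unstable_manifold G p (covering (c t)).
  by rewrite -cW; exists t.
have hb t : history F (b t) by apply: backward_history => //; exact: (W t).1.
have hp : history F (fun n => backward G n p) by exact: backward_history.
(* A piece is indexed by the time [i] from which its points shadow [p], and by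
   the integer parts of their angles before that time. *)
pose P (il : nat * seq int) := [set t | (forall n, (il.1 <= n)%N ->
    circle_dist (backward G n p).2 (b t n).2 < 2^-1) /\
  [seq Num.floor (b t n).2 | n <- iota 0 il.1] = il.2].
suff PN : lebesgue_measure.-negligible
    (\bigcup_il (P il `&` (snd \o c) @^-1` (angle @^-1` N))).
  apply: negligibleS PN => t Nt.
  have [i _ Hi] :
      \forall n \near \oo, torus_dist (backward G n p) (b t n) < 2^-1.
    by apply: (cvgr_lt (0:R)) => //; exact: (W t).2.
  exists (i, [seq Num.floor (b t n).2 | n <- iota 0 i]) => //; split => //.
  by split => // n ni; apply: le_lt_trans (circle_dist_le_torus _ _) (Hi n ni).
apply: negligible_countable_bigcup => -[i l].
apply: negligible_preimage_locally_expanding; last first.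
  exact: negligible_preimage_angle.
(* On a piece the angles stay within distance 1 at all times, so the piece is
   locally a Lipschitz graph over the angle. *)
have graph s t : P (i, l) s -> P (i, l) t -> `|(c s).2 - (c t).2| <= 1 ->
    `|(c s).1 - (c t).1| <= `|(c s).2 - (c t).2|.
  move=> [/= si sl] [/= ti tl] st1.
  apply: (history_graph F_pert (hb s) (hb t)) => // [n|]; last first.
    by apply/eq2pi_sym/eq2pi_sub; exact: eq2pi_angle.
  have [ni|ni] := ltnP n i.
    exists ((b s n).2 - (b t n).2); first exact: eq2pi_refl.
    apply/ltW/dist_lt1_floor.
    have := congr1 (fun l' => nth 0 l' n) (etrans sl (esym tl)).
    by rewrite !(nth_map 0%N) ?size_iota// !nth_iota.
  have S2 q : history F q -> S1 (q n).2 by move=> /(_ n) [[_ ?] _].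
  have [x xs x1] := circle_dist_eq2pi (S2 _ hp) (S2 _ (hb s)) (si n ni).
  have [y yt y1] := circle_dist_eq2pi (S2 _ hp) (S2 _ (hb t)) (ti n ni).
  exists (y - x); last by apply: (le_trans (ler_normB _ _)); lra.
  have := eq2pi_sub yt xs; congr eq2pi; ring.
(* In the sup norm the displacement of [c] is the larger of those of its two
   components, hence that of the angle. *)
move=> t Pt; have [m m0 cm] := derivable_locally_expanding (dc t) (c0 t).
exists m => //; near=> s => Ps.
have ct1 : `|c s - c t| <= 1.
  rewrite distrC; near: s; apply: cvgr_dist_le => //.
  apply: differentiable_continuous; exact/derivable1_diffP.
apply: le_trans (_ : `|c s - c t| <= _); first by near: s.
move: ct1; rewrite prod_normE ge_max => /andP[_ st1].
by rewrite prod_normE ge_max lexx andbT; exact: graph.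
Unshelve. all: by end_near. Qed.

End Leaf.

(** * Projecting an SRB measure to the circle *)

Lemma measurable_angle (R : realType) :
  measurable_fun [set: R] (@angle R).
Proof.
apply: measurable_funB => //; apply: measurable_funM => //.
apply: (@measurableT_comp _ _ _ _ _ _ (fun x : R => (Num.floor x)%:~R : R)).
  apply: nondecreasing_measurable => // x y xy.
  by rewrite ler_int; exact: le_floor.
by apply: measurable_funM.
Qed.

Lemma measurable_euclid3 (R : realType) (c : R -> euclid3 R) :
  continuous c -> [/\ measurable_fun [set: R] (fun t => (c t).1.1),
    measurable_fun [set: R] (fun t => (c t).1.2) &
    measurable_fun [set: R] (fun t => (c t).2)].
Proof.
move=> cc.
have c1 : continuous (fun t => (c t).1).
  by move=> t; apply: continuous_comp (cc t) _; exact: cvg_fst.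
split; apply: continuous_measurable_fun => t.
- by apply: (continuous_comp (c1 t)); exact: cvg_fst.
- by apply: (continuous_comp (c1 t)); exact: cvg_snd.
- by apply: (continuous_comp (cc t)); exact: cvg_snd.
Qed.

Lemma leaf_volume_eq0 (R : realType) (c : R -> euclid3 R)
    (B : set (euclid3 R)) :
  (forall t, derivable c t 1) -> continuous (derive1 c) -> measurable B ->
  lebesgue_measure.-negligible ((covering \o c) @^-1` B) ->
  leaf_volume c B = 0%E.
Proof.
move=> dc cc' mB B0.
have mD : measurable ((covering \o c) @^-1` B).
  rewrite -[X in measurable X]setTI.
  have [|m1 m2 m3] := @measurable_euclid3 R c.
    by move=> t; apply: differentiable_continuous; exact/derivable1_diffP.
  apply: (_ : measurable_fun _ _) => //.
  apply/measurable_fun_pairP; split; first by apply/measurable_fun_pairP.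
  exact: measurableT_comp (@measurable_angle R) m3.
apply: null_set_integral => //; last exact: measure_negligible.
apply/measurable_EFinP; apply: measurable_funTS.
have [m1 m2 m3] := measurable_euclid3 cc'.
apply: (measurableT_comp (continuous_measurable_fun (@sqrt_continuous R))).
by apply: measurable_funD; [apply: measurable_funD|]; apply: measurable_funX.
Qed.

Section Projection.
Variables (R : realType) (F : R -> R).
Local Notation G := (solenoid_lift F).
Hypothesis F_pert : doubling_perturbation 2^-1 F.
Hypothesis f_diffeo : C1_diffeo_onto_image solid_torus (torus_map G).
Variable mu : probability (euclid3 R) R.

Lemma leafwise_ac_angle_null (p : euclid3 R)
    (m : {measure set (euclid3 R) -> \bar R}) (c : R -> euclid3 R)
    (N : set R) :
  attractor G p -> leaf_parametrization (unstable_manifold G p) c ->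
  m `<< leaf_volume c ->
  measurable N -> lebesgue_measure N = 0%E ->
  m (snd @^-1` N) = 0%E.
Proof.
move=> Ap cW; have [dc cc' _ _ _] := cW => mc mN N0.
have mN' : measurable (snd @^-1` N : set (euclid3 R)).
  by rewrite -[X in measurable X]setTI; exact: measurable_snd.
apply: (mc (snd @^-1` N)) => // B mB BN.
apply: leaf_volume_eq0 => //.
have : lebesgue_measure.-negligible N by exact/negligibleP.
move=> /(negligible_leaf_angle_preimage F_pert f_diffeo Ap cW).
by apply: negligibleS => t /BN.
Qed.

(** Invariance comes from the semiconjugacy [snd \o f = T \o snd], which holds
    by computation, and absolute continuity from integrating the conditional
    measures of the set of points with angle in a null set. *)
Lemma SRB_projection_acip : SRB_measure G mu ->
  exists nu : probability R R, circle_acip (circle_map F) nu.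
Proof.
move=> [_ mu_inv [xi [_ _ [kappa [_ [X0 [mX0 X01 X0A] _] mu_kappa] kappa_ac]]]].
pose theta : {mfun (euclid3 R) >-> R} := mfun_Sub (mem_set measurable_snd).
have mtheta N : measurable N -> measurable (snd @^-1` N : set (euclid3 R)).
  by move=> mN; rewrite -[X in measurable X]setTI; exact: measurable_snd.
exists (distribution mu theta); split => [|N mN|].
- apply/eqP; rewrite eq_le probability_le1 /=; last exact: measurable_itv.
  rewrite -X01 le_measure ?inE//; first by apply: mtheta; exact: measurable_itv.
  by move=> q /X0A/(_ 0 Logic.I)[r [_ rS] <-].
- by rewrite -[RHS](mu_inv _ (mtheta N mN)).
apply/null_content_dominatesP => N mN N0.
rewrite -[LHS]/(mu (snd @^-1` N)) mu_kappa; last exact: mtheta.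
rewrite (@ae_eq_integral _ _ _ mu setT (cst 0%E)) ?integral0//; last first.
  have muX0 : {ae mu, forall p, X0 p}.
    exists (~` X0); split => //; first exact: measurableC.
    by rewrite probability_setC// X01 subee.
  apply: filterS2 muX0 kappa_ac => p X0p [c [cW kc]] _ /=.
  exact: (leafwise_ac_angle_null (X0A _ X0p) cW kc mN N0).
by apply: measurable_kernel; exact: mtheta.
Qed.

End Projection.

Theorem lemma6p1 (R : realType) :
  exists2 eps : R, 0 < eps &
  forall F : R -> R,
    doubling_perturbation eps F ->
    C1_diffeo_onto_image solid_torus (torus_map (solenoid_lift F)) ->
    uniformly_hyperbolic (solenoid_lift F) 1 ->
    ~ (exists nu : probability R R, circle_acip (circle_map F) nu) ->
    ~ (exists mu : probability (euclid3 R) R,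
         SRB_measure (solenoid_lift F) mu).
Proof.
(* [1/2] keeps [F'] in [3/2, 5/2] *)
exists 2^-1; first by rewrite invr_gt0.
move=> F F_pert f_diffeo _ no_acip [mu mu_SRB].
exact: no_acip (SRB_projection_acip F_pert f_diffeo mu_SRB).
Qed.
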